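(* Let $f:\mathbb{R}^n\times\mathbb{R}^m\to\mathbb{R}^n$ be continuous and locally Lipschitz continuous in $x$ uniformly in $u$, and assume that the finite-dimensional system $\dot x=f(x,u)$, with inputs $u\in\mathcal{U}=L_\infty(\mathbb{R}_+,\mathbb{R}^m)$, is forward complete. Then the system is LIM if and only if it is ULIM.
   Context: $\mathcal{U}=L_\infty(\mathbb{R}_+,\mathbb{R}^m)$ carries the essential supremum norm $\|\cdot\|_{\mathcal{U}}$; $\phi(t,x,u)$ is the (Carathéodory) solution at time $t$ with initial condition $x$ and input $u$. Forward completeness: $\phi(t,x,u)$ is defined for all $t\ge0$, $x\in\mathbb{R}^n$, $u\in\mathcal{U}$. $|\cdot|$ is the norm on $\mathbb{R}^n$. $\mathcal{K}$: continuous strictly increasing $\gamma:\mathbb{R}_+\to\mathbb{R}_+$ with $\gamma(0)=0$. - LIM: there is $\gamma\in\mathcal{K}\cup\{0\}$ such that for all $x\in\mathbb{R}^n$, $u\in\mathcal{U}$, $\varepsilon>0$ there is $t=t(x,u,\varepsilon)\ge0$ with $|\phi(t,x,u)|\le\varepsilon+\gamma(\|u\|_{\mathcal{U}})$. - ULIM: there is $\gamma\in\mathcal{K}\cup\{0\}$ such that for all $\varepsilon>0$, $r>0$ there is $\tau=\tau(\varepsilon,r)$ such that for all $x$ with $|x|\le r$ and all $u\in\mathcal{U}$ there is $t\le\tau$ with $|\phi(t,x,u)|\le\varepsilon+\gamma(\|u\|_{\mathcal{U}})$. *)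

(* Defs.v *)
From HB Require Import structures.
From mathcomp Require Import all_boot all_order all_algebra.
From mathcomp Require Import all_classical all_reals all_analysis.
From mathcomp Require Import ess_sup_inf.

Set Implicit Arguments.
Unset Strict Implicit.
Unset Printing Implicit Defensive.

Import Order.TTheory GRing.Theory Num.Theory.
Import numFieldNormedType.Exports.

Local Open Scope classical_set_scope.
Local Open Scope ring_scope.

(* The norm |.| on R^k is the Euclidean one; the canonical norm of ['rV[R]_k]
   is the max norm, which induces the same topology and is not used below for
   anything quantitative. *)
Definition enorm (R : realType) (k : nat) (v : 'rV[R]_k) : R :=
  Num.sqrt (\sum_(i < k) v ord0 i ^+ 2).

Definition essnorm (R : realType) (m : nat) (u : R -> 'rV[R]_m) : \bar R :=
  ess_sup (mrestr (@lebesgue_measure R) (measurable_itv `[(0 : R), +oo[))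
          (fun t => (enorm (u t))%:E).

(* U = L_oo(R_+, R^m), by representatives: an input is a function on R whose
   values at negative times are irrelevant.  Measurability is with respect to
   the Borel sets; every L_oo class has a Borel representative. *)
Definition inputs (R : realType) (m : nat) : set (R -> 'rV[R]_m) :=
  [set u : R -> 'rV[R]_m |
     (forall i : 'I_m, measurable_fun `[(0 : R), +oo[ (fun t => u t ord0 i))
     /\ (essnorm u < +oo)%E].

Definition Unorm (R : realType) (m : nat) (u : R -> 'rV[R]_m) : R :=
  fine (essnorm u).

Definition locally_Lipschitz_unif (R : realType) (n m : nat)
    (f : 'rV[R]_n -> 'rV[R]_m -> 'rV[R]_n) : Prop :=
  forall x0 : 'rV[R]_n, exists L d : R, 0 < d /\
    forall (y z : 'rV[R]_n) (v : 'rV[R]_m),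
      enorm (y - x0) < d -> enorm (z - x0) < d ->
      enorm (f y v - f z v) <= L * enorm (y - z).

Definition abs_continuous (R : realType) (V : normedModType R) (a b : R)
    (F : R -> V) : Prop :=
  forall e : R, 0 < e -> exists2 d : R, 0 < d &
    forall (k : nat) (s t : 'I_k -> R),
      (forall i, a <= s i /\ s i <= t i /\ t i <= b) ->
      trivIset [set: 'I_k] (fun i => `]s i, t i[%classic : set R) ->
      \sum_(i < k) (t i - s i) < d ->
      \sum_(i < k) `|F (t i) - F (s i)| < e.

(* Caratheodory solution on [0, +oo[ of x' = f(x, u), x(0) = x. *)
Definition solution (R : realType) (n m : nat)
    (f : 'rV[R]_n -> 'rV[R]_m -> 'rV[R]_n) (x : 'rV[R]_n) (u : R -> 'rV[R]_m)
    (xi : R -> 'rV[R]_n) : Prop :=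
  [/\ xi 0 = x,
      forall T : R, 0 < T -> abs_continuous 0 T xi
    & {ae @lebesgue_measure R, forall t : R, 0 < t ->
         is_derive t 1 xi (f (xi t) (u t))}].

Definition forward_complete (R : realType) (n m : nat)
    (f : 'rV[R]_n -> 'rV[R]_m -> 'rV[R]_n) : Prop :=
  forall (x : 'rV[R]_n) (u : R -> 'rV[R]_m), inputs u ->
    exists xi : R -> 'rV[R]_n, solution f x u xi.

(* When f is continuous and locally Lipschitz in x, solutions are unique on
   [0, +oo[, so for t >= 0 the value does not depend on the choice made by
   [xget] (nor on the representative of u); [cst x] is a dummy default, unused
   under forward completeness. *)
Definition phi (R : realType) (n m : nat)
    (f : 'rV[R]_n -> 'rV[R]_m -> 'rV[R]_n)
    (t : R) (x : 'rV[R]_n) (u : R -> 'rV[R]_m) : 'rV[R]_n :=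
  xget (cst x) [set xi : R -> 'rV[R]_n | solution f x u xi] t.

(* Comparison functions R_+ -> R_+ are the restrictions to [0, +oo[ of
   functions on R; nonnegativity there follows from the other clauses. *)
Definition class_K (R : realType) (g : R -> R) : Prop :=
  [/\ {within `[(0 : R), +oo[, continuous g},
      forall a b : R, 0 <= a -> a < b -> g a < g b
    & g 0 = 0].

Definition class_K0 (R : realType) (g : R -> R) : Prop :=
  class_K g \/ (forall r : R, 0 <= r -> g r = 0).

Definition LIM (R : realType) (n m : nat)
    (f : 'rV[R]_n -> 'rV[R]_m -> 'rV[R]_n) : Prop :=
  exists2 g : R -> R, class_K0 g &
    forall (x : 'rV[R]_n) (u : R -> 'rV[R]_m) (e : R), inputs u -> 0 < e ->
      exists2 t : R, 0 <= t & enorm (phi f t x u) <= e + g (Unorm u).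

Definition ULIM (R : realType) (n m : nat)
    (f : 'rV[R]_n -> 'rV[R]_m -> 'rV[R]_n) : Prop :=
  exists2 g : R -> R, class_K0 g &
    forall e r : R, 0 < e -> 0 < r ->
      exists tau : R, forall (x : 'rV[R]_n) (u : R -> 'rV[R]_m),
        enorm x <= r -> inputs u ->
        exists2 t : R, 0 <= t <= tau & enorm (phi f t x u) <= e + g (Unorm u).

(* Main.v *)
Require Import Defs.
From mathcomp Require Import all_boot all_order all_algebra.
From mathcomp Require Import all_classical all_reals all_analysis.
From mathcomp Require Import ring lra.
Import Order.TTheory GRing.Theory Num.Theory.
Import numFieldNormedType.Exports.

(** LIM provides an entrance time for each pair of an initial state and an
    input; ULIM asks for one entrance time for a whole ball.

    Suppose that uniformity fails for the gain [g + id], where [g] is the gain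
    of LIM.  Then for every [k] there are a state in the ball and an input
    whose trajectory stays outside the target on [[0, k]].  At time 0 this says
    that [g + id] of the input norm is at most the radius of the ball; so the
    identity summand keeps the input norms bounded even if [g] is bounded, and
    both the initial states and the input norms accumulate.  It remains to
    produce a single trajectory that avoids the target forever, which
    contradicts LIM.  Weak limits of the inputs do not help, because a
    limit of trajectories need not be a trajectory unless the set of velocities
    is convex.  Instead one concatenates pieces of
    the given inputs and absorbs the resulting jumps of the state by moving the
    initial state: this is [shadowing].

    The pieces are organised along times [t j] and points [p j] such that
    trajectories of the given family pass arbitrarily near both [p j] at
    [t j] and [p j.+1] at [t j.+1] ([cluster_step]).  The step length
    depends only on a bound for the norm of [p j], and is so short that the
    flow across a step differs from the identity by a map that is Lipschitz
    with constant 1/2 ([solution_tube]).  By contraction the flow is therefore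
    onto a ball around the reference end point ([short_step_onto]), so that a
    correction wanted at time [t j.+1] can be pulled back step by step to time
    0, at most doubling on each step.  This inverts the flow using only the
    solutions that forward completeness supplies.  As the admissible jumps can
    be chosen to decrease geometrically, the corrected initial states
    accumulate, and the solution from an accumulation point follows all the
    pieces ([chain_shadow]).

    The times [t j] tend to infinity: otherwise the step lengths tend to 0, so
    the [p j] are unbounded, and the shadowing solution would be unbounded on a
    bounded interval.  So the same construction excludes that the given
    trajectories escape in finite time.

    The analysis behind all estimates is one mean value inequality for
    absolutely continuous functions, [abs_continuous_mean_value]. *)

Set Implicit Arguments.
Unset Strict Implicit.
Unset Printing Implicit Defensive.
Local Open Scope classical_set_scope.
Local Open Scope ring_scope.

(** * Real induction and compactness *)

Lemma real_induction (R : realType) (a b : R) (P : R -> Prop) :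
  (forall c, a <= c <= b -> (forall s, a <= s < c -> P s) ->
    exists2 d, 0 < d & forall t, c <= t < c + d -> t <= b -> P t) ->
  forall t, a <= t <= b -> P t.
Proof.
move=> step t0 t0ab; apply: contrapT => nPt0.
pose E := [set t | a <= t <= b /\ ~ P t].
have lbE : lbound E a by move=> t [/andP[]].
have infE : has_inf E by split; [exists t0 | exists a].
have ac : a <= inf E by apply: lb_le_inf => //; case: infE.
have cb : inf E <= b.
  apply: (@le_trans _ _ t0); last by case/andP: t0ab.
  by apply: ge_inf => //; exists a.
have [||d d0 Pd] := step (inf E); first by rewrite ac.
  move=> s /andP[as' sc]; apply: contrapT => nPs.
  have : inf E <= s.
    apply: ge_inf; first by exists a.
    by split=> //; rewrite as' (le_trans (ltW sc)).
  by rewrite leNgt sc.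
have [t [/andP[at' tb] nPt] tlt] := inf_adherent d0 infE.
apply: (nPt); apply: Pd => //; rewrite tlt andbT.
by apply: ge_inf; [exists a | split=> //; apply/andP].
Qed.

(** A bound that improves itself strictly propagates along an interval.  It
    replaces the usual first-exit-time argument. *)
Lemma barrier (R : realType) (g : R -> R) (a b k k' : R) : k' < k ->
  (forall e, 0 < e -> exists2 d, 0 < d & forall s t,
     a <= s <= b -> a <= t <= b -> `|t - s| < d -> g t < g s + e) ->
  (forall c, a <= c <= b -> (forall s, a <= s < c -> g s <= k) -> g c <= k') ->
  forall t, a <= t <= b -> g t <= k'.
Proof.
move=> kk' cg step.
have gk : forall t, a <= t <= b -> g t <= k.
  apply: real_induction => c /andP[ac cb] gc.
  have gck' : g c <= k' by apply: step; rewrite ?ac.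
  have [|d d0 Hd] := cg (k - k'); first by rewrite subr_gt0.
  exists d => // t /andP[ct tcd] tb.
  have : g t < g c + (k - k').
    apply: Hd; [by rewrite ac|by rewrite (le_trans ac ct)|].
    by rewrite ger0_norm ?subr_ge0// ltrBlDl.
  by move=> H; apply: ltW; lra.
move=> t /andP[at' tb]; apply: step; first by rewrite at'.
move=> s /andP[as' st]; apply: gk; rewrite as'.
by apply: le_trans tb; exact: ltW.
Qed.

(** The form in which compactness of balls is used below: not a convergent
    subsequence, but arbitrarily late terms close to the cluster point. *)
Lemma compact_cluster_point (T : topologicalType) (A : set T) (x : nat -> T) :
  compact A -> (forall k, A (x k)) ->
  exists2 p, A p &
    forall B, nbhs p B -> forall N, exists2 k, (N <= k)%N & B (x k).
Proof.
move=> cA xA; have [|p [Ap clp]] := cA (x @ \oo) _.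
  by exists 0%N => // k _; exact: xA.
exists p => // B pB N.
have [|_ [[k Nk <-] Bx]] := clp [set x k | k in [set k | (N <= k)%N]] B _ pB.
  by exists N => // k /= Nk; exists k.
by exists k.
Qed.

(** * A mean value inequality for absolutely continuous functions *)

Lemma is_derive_local_bound (R : realType) (V : normedModType R) (F : R -> V)
    (c K : R) (dF : V) : is_derive c 1 F dF -> `|dF| < K ->
  exists2 d, 0 < d & forall t, `|t - c| < d -> `|F t - F c| <= K * `|t - c|.
Proof.
move=> [dFc eF] dFK.
have cv : h^-1 *: ((F \o shift c) (h *: 1) - F c) @[h --> 0^'] --> dF.
  by rewrite -eF; exact: dFc.
have /cvgrPdist_lt /(_ (K - `|dF|)) := cv.
rewrite subr_gt0 => /(_ dFK) [d /= d0 Hd].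
exists d => // t tc; have [->|tNc] := eqVneq t c.
  by rewrite !subrr !normr0 mulr0.
have h0 : t - c != 0 by rewrite subr_eq0.
have := Hd (t - c); rewrite /= sub0r normrN => /(_ tc h0).
rewrite /shift /= /GRing.scale/= mulr1 subrK => H.
have {}H : `|(t - c)^-1 *: (F t - F c)| < K.
  rewrite -[X in `|X|](subKr dF).
  by apply: le_lt_trans (ler_normB _ _) _; rewrite -ltrBrDl.
move: H; rewrite normrZ normfV mulrC ltr_pdivrMr ?normr_gt0// => /ltW //.
Qed.

Section AbsolutelyContinuous.
Variables (R : realType) (V : normedModType R).
Implicit Types (F : R -> V).

Lemma abs_continuousB (a b : R) F G :
  abs_continuous a b F -> abs_continuous a b G ->
  abs_continuous a b (fun t => F t - G t).
Proof.
move=> aF aG e e0; have e20 : 0 < e / 2 by rewrite divr_gt0.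
have [d1 d10 H1] := aF _ e20; have [d2 d20 H2] := aG _ e20.
exists (Num.min d1 d2); first by rewrite lt_min d10.
move=> k s t st tr; rewrite lt_min => /andP[/H1 {}H1 /H2 {}H2].
rewrite [e]splitr; apply: le_lt_trans (ltrD (H1 st tr) (H2 st tr)).
rewrite -big_split /=; apply: ler_sum => i _.
by rewrite opprD addrACA -opprD; apply: ler_normB.
Qed.

Lemma abs_continuous_dist (a b e : R) F : abs_continuous a b F -> 0 < e ->
  exists2 d, 0 < d & forall s t, a <= s <= b -> a <= t <= b ->
    `|t - s| < d -> `|F t - F s| < e.
Proof.
move=> aF /aF[d d0 Hd]; exists d => //.
have H s t : a <= s <= b -> a <= t <= b -> s <= t -> t - s < d ->
    `|F t - F s| < e.
  move=> /andP[as' sb] /andP[at' tb] st ts.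
  have := Hd 1%N (fun=> s) (fun=> t); rewrite !big_ord1; apply => //.
  by apply/trivIsetP => i j _ _; rewrite (ord1 i) (ord1 j).
move=> s t hs ht; have [st|/ltW ts] := leP s t.
  by rewrite ger0_norm ?subr_ge0//; exact: H.
by rewrite distrC (distrC (F t)) ger0_norm ?subr_ge0//; exact: H.
Qed.

(** The increment of [F] on [[a, t]] is controlled by slope [K], up to the
    increments over finitely many disjoint intervals inside [U].  With [U] a
    small open neighbourhood of the exceptional null set, absolute continuity
    makes the second part small. *)
Definition good_cover (U : set R) (K a : R) F (t : R) : Prop :=
  exists k (l r : nat -> R),
    [/\ forall i, (i < k)%N -> [/\ a <= l i, l i <= r i & r i <= t],
        forall i, (i < k)%N -> `]l i, r i[ `<=` U,
        trivIset `I_k (fun i => `]l i, r i[%classic : set R)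
      & `|F t - F a| <= K * (t - a) + \sum_(i < k) `|F (r i) - F (l i)|].

Lemma good_cover_refl U K a F : good_cover U K a F a.
Proof.
exists 0%N, (fun=> a), (fun=> a); split=> //.
by rewrite !subrr normr0 mulr0 big_ord0 addr0.
Qed.

Lemma good_cover_lip U K a F s t : good_cover U K a F s -> s <= t ->
  `|F t - F s| <= K * (t - s) -> good_cover U K a F t.
Proof.
move=> [k [l [r [H1 H2 H3 H4]]]] st Fst; exists k, l, r; split=> //.
  by move=> i /H1[? ? ?]; split=> //; apply: le_trans st.
rewrite -(subrKA (F s)).
apply: le_trans (ler_normD _ _) _; apply: le_trans (lerD Fst H4) _.
by rewrite addrA -mulrDr subrKA.
Qed.

Lemma good_cover_open U K a F s t : 0 <= K -> a <= s ->
  good_cover U K a F s -> s <= t ->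
  `]s, t[ `<=` U -> good_cover U K a F t.
Proof.
move=> K0 as' [k [l [r [H1 H2 H3 H4]]]] st Ost.
exists k.+1, (fun i => if (i < k)%N then l i else s),
  (fun i => if (i < k)%N then r i else t); split=> //.
- move=> i; rewrite ltnS leq_eqVlt; case: ifP => [/H1[? ? ?] _|_ _]; split=> //.
  exact: le_trans st.
- by move=> i _; case: ifP => // /H2.
- apply/trivIsetP => i j /= ik jk ij; apply/seteqP; split=> // x [].
  case: ifP => ik'; case: ifP => jk' /=; rewrite !in_itv /=.
  + move=> xi xj; have /trivIsetP/(_ i j ik' jk' ij) := H3.
    by move/seteqP => [/(_ x) + _]; apply; split; rewrite /= in_itv.
  + have [_ _ rs] := H1 _ ik'.
    move=> /andP[_ xr] /andP[sx _].
    by have := lt_trans (lt_le_trans xr rs) sx; rewrite ltxx.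
  + have [_ _ rs] := H1 _ jk'.
    move=> /andP[sx _] /andP[_ xr].
    by have := lt_trans (lt_le_trans xr rs) sx; rewrite ltxx.
  + move=> _ _; suff : i = j by move/eqP: ij.
    have eqk q : (q < k.+1)%N -> (q < k)%N = false -> q = k.
      by rewrite ltnS leq_eqVlt => /orP[/eqP//|->].
    by rewrite (eqk i)// (eqk j).
- rewrite big_ord_recr /= ltnn -(subrKA (F s)).
  under eq_bigr => i _ do rewrite ltn_ord.
  apply: le_trans (ler_normD _ _) _.
  rewrite [leLHS]addrC [leRHS]addrA lerD2r; apply: le_trans H4 _; rewrite lerD2r.
  by apply: ler_wpM2l => //; rewrite lerD2r.
Qed.

Lemma sum_length_le (U : set R) k (l r : 'I_k -> R) (d : R) :
  measurable U -> (lebesgue_measure U < d%:E)%E ->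
  (forall i, l i <= r i) ->
  (forall i, `]l i, r i[ `<=` U) ->
  trivIset [set: 'I_k] (fun i => `]l i, r i[%classic : set R) ->
  \sum_(i < k) (r i - l i) < d.
Proof.
move=> mO Od lr lrO tr.
rewrite -lte_fin; apply: le_lt_trans Od.
have -> : (\sum_(i < k) (r i - l i))%:E =
    (\sum_(i < k) lebesgue_measure (`]l i, r i[%classic : set R))%E.
  rewrite -sumEFin; apply: eq_bigr => i _; rewrite lebesgue_measure_itv /= lte_fin.
  have [_|rl] := ltP; first by rewrite EFinB.
  by have -> : l i = r i; [apply: le_anti; rewrite lr | rewrite subrr].
rewrite -measure_semi_additive_ord//; last exact: bigsetU_measurable.
apply: le_measure; rewrite ?inE//; first exact: bigsetU_measurable.
apply: (big_ind (fun A : set R => A `<=` U)) => // A B AO BO.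
by rewrite subUset.
Qed.

(** Outer regularity, for a set that is only contained in a measurable null
    set. *)
Lemma null_open_cover (N : set R) (d : R) :
  (@lebesgue_measure R).-negligible N -> 0 < d ->
  exists U : set R, [/\ open U, N `<=` U & (lebesgue_measure U < d%:E)%E].
Proof.
move=> [A [mA A0 NA]] d0.
have Aoo : (lebesgue_measure A < +oo)%E by rewrite A0 ltry.
have [U [oU AU Ud]] := lebesgue_regularity_outer mA Aoo d0.
exists U; split=> //; first exact: subset_trans NA AU.
apply: le_lt_trans Ud.
have -> : lebesgue_measure U = lebesgue_measure (A `|` (U `\` A)).
  by rewrite setDUK.
apply: le_trans (measureU2 _ _ _) _ => //.
  by apply: measurableD => //; exact: measurable_realfun.open_measurable.
by rewrite [X in (X + _)%E](_ : _ = 0%E) ?add0e.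
Qed.

(** Enclose the null set where the derivative bound fails, together with the two
    end points, in an open set [U] of small measure.  Real induction shows that
    [[a, b]] has a good cover: a point of [U] has a neighbourhood inside [U],
    whose increment is charged to [U], and at any other point the derivative
    bounds the increments on both sides.  The part charged to [U] has small
    total length, hence small total increment by absolute continuity. *)
Theorem abs_continuous_mean_value (T a b M : R) F :
  abs_continuous 0 T F -> 0 <= a -> a <= b -> b <= T -> 0 <= M ->
  {ae @lebesgue_measure R, forall t, a < t < b ->
    exists2 dF : V, is_derive t 1 F dF & `|dF| <= M} ->
  `|F b - F a| <= M * (b - a).
Proof.
move=> acF a0 ab bT M0 [N1 [mN1 N10 HN1]].
suff H e : 0 < e -> `|F b - F a| <= M * (b - a) + e * (b - a + 1).
  apply/ler_addgt0Pr => e e0.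
  have ba1 : 0 < b - a + 1 by rewrite ltr_wpDl ?subr_ge0.
  have /H : 0 < e / (b - a + 1) by rewrite divr_gt0.
  by rewrite divfK // gt_eqF.
move=> e0; have [d d0 Hd] := acF _ e0.
pose N := N1 `|` [set a] `|` [set b].
have nN : (@lebesgue_measure R).-negligible N.
  apply: negligibleU; first apply: negligibleU.
  - by exists N1; split=> //; exact: subset_refl.
  - exists [set a]; split; [exact: measurable_set1| |exact: subset_refl].
    exact: lebesgue_measure_set1.
  - exists [set b]; split; [exact: measurable_set1| |exact: subset_refl].
    exact: lebesgue_measure_set1.
have [U [oU NU Ud]] := null_open_cover nN d0.
pose K := M + e.
have K0 : 0 <= K by rewrite addr_ge0 // ltW.
have Kgood : good_cover U K a F b.
  apply: (real_induction (a := a) (b := b)); last by rewrite ab lexx.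
  move=> c /andP[ac cb] Pc.
  have good_before d1 : 0 < d1 -> exists s,
      [/\ a <= s, s <= c, c - s < d1 & good_cover U K a F s].
    move=> d10; have [-> |aNc] := eqVneq a c.
      by exists c; rewrite subrr; split=> //; exact: good_cover_refl.
    have ltac : a < c by rewrite lt_neqAle aNc.
    exists (Num.max a (c - d1 / 2)).
    have mc : Num.max a (c - d1 / 2) < c.
      by rewrite gt_max ltac /= ltrBlDr ltrDl divr_gt0.
    split.
    - by rewrite le_max lexx.
    - exact: ltW.
    - rewrite ltrBlDl -ltrBlDr lt_max; apply/orP; right; lra.
    - by apply: Pc; rewrite mc le_max lexx.
  have [Uc|NUc] := pselect (U c).
    have /nbhs_ballP[d1 /= d10 Hd1] : nbhs c U by apply: open_nbhs_nbhs.
    exists d1 => // t /andP[ct tc] tb.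
    have [s [as' sc cs gs]] := good_before d1 d10.
    apply: (good_cover_open K0 as' gs); first exact: le_trans ct.
    move=> x /=; rewrite in_itv /= => /andP[sx xt]; apply: Hd1.
    by rewrite /ball /= ltr_distlC; apply/andP; split; lra.
  have Nc : ~ N c by move=> /NU.
  have [dF dFc dFM] : exists2 dF : V, is_derive c 1 F dF & `|dF| <= M.
    have ltac : a < c.
      rewrite lt_neqAle ac andbT; apply/eqP => aEc; apply: Nc; left; right.
      by rewrite /= aEc.
    have ltcb : c < b.
      rewrite lt_neqAle cb andbT; apply/eqP => cEb; apply: Nc; right.
      by rewrite /= cEb.
    apply: contrapT => nH; apply: Nc; left; left; apply: HN1 => /= H.
    by apply: nH; apply: H; rewrite ltac.
  have [|d1 d10 Hd1] := is_derive_local_bound dFc (_ : _ < K).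
    by apply: le_lt_trans dFM _; rewrite ltrDl.
  exists d1 => // t /andP[ct tc] tb.
  have [s [as' sc cs gs]] := good_before d1 d10.
  have gc : good_cover U K a F c.
    apply: (good_cover_lip gs sc); rewrite distrC.
    rewrite -[c - s]ger0_norm ?subr_ge0// (distrC c s); apply: Hd1.
    by rewrite distrC ger0_norm ?subr_ge0.
  apply: (good_cover_lip gc ct).
  rewrite -[X in K * X]ger0_norm ?subr_ge0//; apply: Hd1.
  by rewrite ger0_norm ?subr_ge0// ltrBlDl.
have [k [l [r [H1 H2 H3 H4]]]] := Kgood.
apply: le_trans H4 _; rewrite /K mulrDl [e * (_ + 1)]mulrDr mulr1 addrA lerD2l.
apply/ltW/(Hd k (fun i => l i) (fun i => r i)).
- move=> i; have [h1 h2 h3] := H1 i (ltn_ord i); split; first exact: le_trans h1.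
  by split=> //; apply: le_trans bT.
- apply/trivIsetP => i j _ _ ij; move/trivIsetP: H3; apply => //=.
- apply: (sum_length_le (U := U)) => //; first exact: measurable_realfun.open_measurable.
  + by move=> i; have [] := H1 i (ltn_ord i).
  + by move=> i; apply: H2.
  + by apply/trivIsetP => i j _ _ ij; move/trivIsetP: H3; apply => //=.
Qed.

End AbsolutelyContinuous.

(** * The Euclidean and the maximum norm *)

Section EuclideanNorm.
Variables (R : realType) (n : nat).
Implicit Types v w : 'rV[R]_n.

Lemma normr_entry_le v i : `|v ord0 i| <= `|v|.
Proof.
rewrite [leRHS]/Num.Def.normr /= mx_normrE; apply/bigmax_geP; right => /=.
by exists (ord0, i).
Qed.

Lemma sum_sqr_ge0 v : 0 <= \sum_(i < n) v ord0 i ^+ 2.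
Proof. by apply: sumr_ge0 => i _; exact: sqr_ge0. Qed.

Lemma sqr_enorm v : enorm v ^+ 2 = \sum_(i < n) v ord0 i ^+ 2.
Proof. by rewrite sqr_sqrtr// sum_sqr_ge0. Qed.

Lemma normr_le_enorm v : `|v| <= enorm v.
Proof.
rewrite [leLHS]/Num.Def.normr /= mx_normrE; apply/bigmax_leP; split=> [|[i j] _ /=].
  exact: sqrtr_ge0.
rewrite (ord1 i) -sqrtr_sqr ler_wsqrtr//.
by rewrite (bigD1 j)//= lerDl; apply: sumr_ge0 => k _; exact: sqr_ge0.
Qed.

Lemma enorm_le_normr v : enorm v <= n.+1%:R * `|v|.
Proof.
rewrite -ler_sqr ?nnegrE ?sqrtr_ge0 ?mulr_ge0// sqr_enorm.
apply: (@le_trans _ _ (\sum_(i < n) `|v| ^+ 2)).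
  apply: ler_sum => i _; rewrite -real_normK ?num_real//.
  by rewrite ler_sqr ?nnegrE// normr_entry_le.
rewrite sumr_const card_ord -[leLHS]mulr_natl exprMn ler_wpM2r ?sqr_ge0//.
by rewrite -natrX ler_nat; apply: leq_trans (leqnSn n) _; rewrite leq_pmulr.
Qed.

(** Cauchy-Schwarz, from summing the squares of [B v_i - A w_i], where [A] and
    [B] are the norms of [v] and [w]. *)
Lemma dot_le_enorm v w : \sum_(i < n) v ord0 i * w ord0 i <= enorm v * enorm w.
Proof.
have [v0|vN0] := eqVneq (enorm v) 0.
  rewrite v0 mul0r big1 // => i _.
  have : `|v ord0 i| <= 0.
    by rewrite -v0; exact: le_trans (normr_entry_le v i) (normr_le_enorm v).
  by rewrite normr_le0 => /eqP ->; rewrite mul0r.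
have [w0|wN0] := eqVneq (enorm w) 0.
  rewrite w0 mulr0 big1 // => i _.
  have : `|w ord0 i| <= 0.
    by rewrite -w0; exact: le_trans (normr_entry_le w i) (normr_le_enorm w).
  by rewrite normr_le0 => /eqP ->; rewrite mulr0.
have vw0 : 0 < enorm v * enorm w.
  by rewrite mulr_gt0// lt_neqAle eq_sym ?vN0 ?wN0 sqrtr_ge0.
set A := enorm v; set B := enorm w.
rewrite -(ler_pM2l vw0) -/A -/B -(ler_pM2l (ltr0n R 2)).
have -> : 2 * (A * B * (A * B)) =
    \sum_(i < n) (B ^+ 2 * v ord0 i ^+ 2 + A ^+ 2 * w ord0 i ^+ 2).
  rewrite big_split /= -!mulr_sumr -!sqr_enorm -/A -/B; lra.
rewrite !mulr_sumr; apply: ler_sum => i _.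
have := sqr_ge0 (B * v ord0 i - A * w ord0 i); lra.
Qed.

Lemma enormD v w : enorm (v + w) <= enorm v + enorm w.
Proof.
rewrite -ler_sqr ?nnegrE ?addr_ge0 ?sqrtr_ge0// sqr_enorm.
under eq_bigr => i _ do rewrite mxE sqrrD.
rewrite !big_split /= -!sqr_enorm sqrrD lerD2r lerD2l.
by rewrite mulr2n lerD // dot_le_enorm.
Qed.

(** All estimates along trajectories are made in the maximum norm; this
    transfers them to the Euclidean norm in which the target is defined. *)
Lemma enorm_dist_le v w : enorm v <= enorm w + n.+1%:R * `|v - w|.
Proof.
rewrite -[in leLHS](subrK w v) addrC; apply: le_trans (enormD _ _) _.
by rewrite lerD2l enorm_le_normr.
Qed.

Lemma compact_norm_ball (c : 'rV[R]_n) (r : R) :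
  compact [set v : 'rV[R]_n | `|v - c| <= r].
Proof.
apply: bounded_closed_compact.
  exists (r + `|c|); split; first exact: num_real.
  move=> x cx v /= vr; apply: le_trans (ltW cx).
  by rewrite -[v](subrK c); apply: le_trans (ler_normD _ _) _; rewrite lerD2r.
apply: preimage_closed (@closed_le R r) => v _; apply: continuous_comp.
  exact: cvgB cvg_id (cvg_cst _).
exact: norm_continuous.
Qed.

Lemma compact_norm_ball0 (r : R) : compact [set v : 'rV[R]_n | `|v| <= r].
Proof.
have := @compact_norm_ball 0 r; congr compact.
by apply/seteqP; split=> v /=; rewrite subr0.
Qed.

End EuclideanNorm.

(** The increments of the iterates of [G] decay geometrically, so any cluster
    point of the iterates is fixed. *)
Lemma half_contraction_fixpoint (R : realType) (n : nat) (G : 'rV[R]_n -> 'rV[R]_n)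
    (c : 'rV[R]_n) (r : R) : 0 <= r ->
  (forall z, `|z - c| <= r -> `|G z - c| <= r) ->
  (forall z z', `|z - c| <= r -> `|z' - c| <= r ->
    `|G z - G z'| <= `|z - z'| / 2) ->
  exists2 z, `|z - c| <= r & G z = z.
Proof.
move=> r0 GU Gc; pose z k := iter k G c.
have zU k : `|z k - c| <= r by elim: k => [|k]; [rewrite subrr normr0 | exact: GU].
have zS k : `|z k.+1 - z k| * 2 ^+ k <= r.
  elim: k => [|k IH]; first by rewrite expr0 mulr1; exact: zU.
  apply: le_trans IH; have := Gc _ _ (zU k.+1) (zU k).
  rewrite exprS mulrA -/(z k.+2); have : 0 <= 2 ^+ k :> R by rewrite exprn_ge0.
  by move=> k0 /(ler_wpM2r k0); rewrite /z !iterS; lra.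
have [p pU clp] := compact_cluster_point (@compact_norm_ball R n c r) zU.
exists p => //; apply/eqP; rewrite -subr_eq0 -normr_le0.
apply/ler_addgt0Pr => e e0; rewrite add0r.
have e40 : 0 < e / 4 by rewrite divr_gt0.
have [k Nk] := clp _ (nbhsx_ballx p _ e40) (Num.truncn (2 * r / e)).+1.
rewrite -ball_normE /= => pzk.
have zSk : `|z k.+1 - z k| <= e / 2.
  have k2 : 2 * r / e <= 2 ^+ k.
    apply: ltW; apply: lt_le_trans (truncnS_gt _) _; rewrite -natrX ler_nat.
    by apply: leq_trans Nk _; rewrite ltnW// ltn_expl.
  have k0 : 0 < 2 ^+ k :> R by rewrite exprn_gt0.
  rewrite -(ler_pM2r k0); apply: le_trans (zS k) _.
  by move: k2; rewrite ler_pdivrMr//; lra.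
have -> : G p - p = (G p - G (z k)) + ((z k.+1 - z k) + (z k - p)).
  by rewrite [z k.+1]iterS !subrKA.
apply: le_trans (ler_normD _ _) _.
have := ler_normD (z k.+1 - z k) (z k - p).
have := Gc _ _ pU (zU k); rewrite (distrC (z k) p); lra.
Qed.

(** * Uniform estimates for the vector field *)

Section VectorField.
Variables (R : realType) (n m : nat).
Variable f : 'rV[R]_n -> 'rV[R]_m -> 'rV[R]_n.

(** A Lebesgue number argument: by compactness the radius and the constant of
    the local Lipschitz condition can be chosen uniformly over a ball.  The
    uniform radius [d] suffices, as trajectories are only compared when they
    are close to each other. *)
Lemma Lipschitz_tube (K : R) : locally_Lipschitz_unif f ->
  exists L d, [/\ 0 <= L, 0 < d &
    forall x y z v, `|x| <= K -> `|y - x| <= d -> `|z - x| <= d ->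
      `|f y v - f z v| <= L * `|y - z|].
Proof.
move=> lf; apply: contrapT => nH.
pose d k : R := k.+1%:R^-1.
have d0 k : 0 < d k by rewrite invr_gt0.
have : forall k : nat, exists q : 'rV[R]_n * 'rV[R]_n * 'rV[R]_n * 'rV[R]_m,
    [/\ `|q.1.1.1| <= K, `|q.1.1.2 - q.1.1.1| <= d k,
        `|q.1.2 - q.1.1.1| <= d k
      & k%:R * `|q.1.1.2 - q.1.2| < `|f q.1.1.2 q.2 - f q.1.2 q.2|].
  move=> k; apply: contrapT => nq; apply: nH; exists k%:R, (d k); split=> //.
  move=> x y z v xK yd zd; rewrite leNgt; apply/negP => yz; apply: nq.
  by exists (x, y, z, v).
move=> /choice[q Hq].
have [|p _ clp] := compact_cluster_point (x := fun k => (q k).1.1.1)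
    (@compact_norm_ball0 R n K); first by move=> k; have [] := Hq k.
have [L [e [e0 He]]] := lf p.
pose c : R := n.+1%:R.
have c0 : 0 < c by rewrite ltr0n.
have e20 : 0 < e / (2 * c) by rewrite divr_gt0 // mulr_gt0.
have pB := nbhsx_ballx p (e / (2 * c)) e20.
pose N := maxn (Num.truncn (`|L| * c)).+1 (Num.truncn (2 * c / e)).+1.
have [k Nk] := clp _ pB N; rewrite -ball_normE /= => pxk.
have [_ yx zx] := Hq k; apply/negP; rewrite -leNgt.
have dk : d k < e / (2 * c).
  rewrite -[e / _]invf_div ltf_pV2 ?posrE ?divr_gt0 ?mulr_gt0//.
  apply: lt_le_trans (truncnS_gt _) _; rewrite ler_nat.
  by apply: leq_trans (leqW Nk); exact: leq_maxr.
have near_p w : `|w - (q k).1.1.1| <= d k -> enorm (w - p) < e.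
  move=> wx; apply: le_lt_trans (enorm_le_normr _) _.
  rewrite -/c mulrC -ltr_pdivlMr //.
  rewrite -(subrKA (q k).1.1.1); apply: le_lt_trans (ler_normD _ _) _.
  have -> : e / c = e / (2 * c) + e / (2 * c).
    by field; rewrite gt_eqF.
  by apply: ltrD; [exact: le_lt_trans dk | rewrite distrC].
apply: le_trans (normr_le_enorm _) _.
apply: le_trans (He _ _ _ (near_p _ yx) (near_p _ zx)) _.
apply: (@le_trans _ _ (`|L| * (c * `|(q k).1.1.2 - (q k).1.2|))).
  apply: le_trans (ler_wpM2r _ (ler_norm L)) _; first exact: sqrtr_ge0.
  by apply: ler_wpM2l => //; exact: enorm_le_normr.
rewrite mulrA; apply: ler_wpM2r => //.
apply/ltW; apply: lt_le_trans (truncnS_gt _) _; rewrite ler_nat.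
by apply: leq_trans Nk; exact: leq_maxl.
Qed.

Lemma field_bounded (K c : R) :
  continuous (fun p : 'rV[R]_n * 'rV[R]_m => f p.1 p.2) ->
  exists2 B, 0 <= B &
    forall x v, `|x| <= K -> enorm v <= c -> `|f x v| <= B.
Proof.
move=> cf.
have cK := compact_setX (@compact_norm_ball0 R n K)
  (@compact_norm_ball0 R m c).
have [M [_ HM]] :=
  compact_bounded (continuous_compact (continuous_subspaceT cf) cK).
exists (`|M| + 1); first by rewrite addr_ge0.
move=> x v xK vc; apply: (HM (`|M| + 1)).
  by rewrite (le_lt_trans (ler_norm M))// ltrDl.
exists (x, v) => //=.
by split=> //=; exact: le_trans (normr_le_enorm v) vc.
Qed.

End VectorField.

(** * Solutions *)

Section Solutions.
Variables (R : realType) (n m : nat).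
Variable f : 'rV[R]_n -> 'rV[R]_m -> 'rV[R]_n.
Implicit Types (x y : R -> 'rV[R]_n) (u w : R -> 'rV[R]_m).

Lemma phi_solution p u : forward_complete f -> inputs u ->
  solution f p u (fun t => phi f t p u).
Proof. by move=> fc iu; have := xgetPex (cst p) (fc p u iu). Qed.

Lemma phi0 p u : forward_complete f -> inputs u -> phi f 0 p u = p.
Proof. by move=> fc iu; have [] := phi_solution p fc iu. Qed.

Lemma solution_init p u x : solution f p u x -> solution f (x 0) u x.
Proof. by move=> sx; have [-> _ _] := sx. Qed.

Lemma solution_continuous p u x : solution f p u x ->
  forall T e, 0 < e -> exists2 d, 0 < d &
    forall s t, 0 <= s <= T -> 0 <= t <= T -> `|t - s| < d -> `|x t - x s| < e.
Proof.
move=> [_ acx _] T e e0.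
have T0 : 0 < Num.max T 1 by rewrite lt_max ltr01 orbT.
have [d d0 Hd] := abs_continuous_dist (acx _ T0) e0.
exists d => // s t /andP[s0 sT] /andP[t0 tT].
by apply: Hd; rewrite ?s0 ?t0 le_max ?sT ?tT.
Qed.

Lemma solution_bounded p u x (T : R) : solution f p u x ->
  exists M, forall s, 0 <= s <= T -> `|x s| <= M.
Proof.
move=> sx; apply: contrapT => nb.
have : forall k : nat, exists s, 0 <= s <= T /\ k%:R < `|x s|.
  move=> k; apply: contrapT => ns; apply: nb; exists k%:R => s sT.
  by rewrite leNgt; apply/negP => ks; apply: ns; exists s.
move=> /choice[s Hs].
have sT k : `[0, T]%classic (s k).
  by rewrite /= in_itv /=; have [] := Hs k.
have [r rT clr] := compact_cluster_point (@segment_compact R 0 T) sT.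
have [d d0 Hd] := solution_continuous sx T (ltr01 : 0 < 1 :> R).
have [k Nk] := clr _ (nbhsx_ballx r d d0) (Num.truncn (`|x r| + 1)).+1.
rewrite -ball_normE /= distrC => skr; have [sk xk] := Hs k.
have rT' : 0 <= r <= T by move: rT; rewrite /= in_itv.
have := Hd _ _ rT' sk skr; apply/negP; rewrite -leNgt.
have : `|x r| + 1 < k%:R.
  by apply: lt_le_trans (truncnS_gt _) _; rewrite ler_nat.
have := lerB_dist (x (s k)) (x r); lra.
Qed.

(** The bound on the vector field is only available for input values of norm at
    most [c], hence almost everywhere. *)
Lemma solution_increment_le p u x (a b M c : R) : solution f p u x ->
  0 <= a -> a <= b -> 0 <= M ->
  {ae @lebesgue_measure R, forall t, 0 <= t -> enorm (u t) <= c} ->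
  (forall t, a < t < b -> enorm (u t) <= c -> `|f (x t) (u t)| <= M) ->
  `|x b - x a| <= M * (b - a).
Proof.
move=> [_ acx dx] a0 ab M0 uc fM.
have T0 : 0 < Num.max b 1 by rewrite lt_max ltr01 orbT.
apply: (abs_continuous_mean_value (acx _ T0)) => //.
  by rewrite le_max lexx.
apply: (@filterS2 _ _ (ae_filter_ringOfSetsType _)) dx uc => t dxt uct /andP[at' tb].
have t0 : 0 < t by exact: le_lt_trans at'.
exists (f (x t) (u t)); first exact: dxt.
by apply: fM; [rewrite at' | apply: uct; exact: ltW].
Qed.

Lemma solution_diff_le p u x q w y (a b M : R) :
  solution f p u x -> solution f q w y -> 0 <= a -> a <= b -> 0 <= M ->
  (forall t, a < t < b -> w t = u t) ->
  (forall t, a < t < b -> `|f (x t) (u t) - f (y t) (u t)| <= M) ->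
  `|(x b - y b) - (x a - y a)| <= M * (b - a).
Proof.
move=> [_ acx dx] [_ acy dy] a0 ab M0 wu fM.
have T0 : 0 < Num.max b 1 by rewrite lt_max ltr01 orbT.
apply: (abs_continuous_mean_value (abs_continuousB (acx _ T0) (acy _ T0))) => //.
  by rewrite le_max lexx.
apply: (@filterS2 _ _ (ae_filter_ringOfSetsType _)) dx dy
  => t dxt dyt tab; have /andP[at' tb] := tab.
have t0 : 0 < t by exact: le_lt_trans at'.
exists (f (x t) (u t) - f (y t) (u t)); last exact: fM.
apply: is_deriveB; first exact: dxt.
by rewrite -wu //; exact: dyt.
Qed.

End Solutions.

(** * The flow across a short step *)

Section ShortSteps.
Variables (R : realType) (n m : nat).
Variable f : 'rV[R]_n -> 'rV[R]_m -> 'rV[R]_n.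
Implicit Types (x y : R -> 'rV[R]_n) (u w : R -> 'rV[R]_m).

(** As long as the solution is in the unit ball around [q] its speed is at most
    [B], so it moves by at most 1/4 and does not come close to the boundary. *)
Lemma solution_stays_near p u x q (a h c B : R) : solution f p u x ->
  0 <= a -> 0 <= B -> B * h <= 1 / 4 ->
  {ae @lebesgue_measure R, forall t, 0 <= t -> enorm (u t) <= c} ->
  (forall z v, `|z - q| <= 1 -> enorm v <= c -> `|f z v| <= B) ->
  `|x a - q| <= 1 / 2 ->
  forall t, a <= t <= a + h -> `|x t - q| <= 1.
Proof.
move=> sx a0 B0 Bh uc fB xaq t tah.
apply: (@le_trans _ _ (3 / 4)); last by lra.
apply: (barrier (g := fun t => `|x t - q|) (k := 1) _ _ _ tah); first by lra.
  move=> e e0; have [d d0 Hd] := solution_continuous sx (a + h) e0.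
  exists d => // s r /andP[as' sb] /andP[ar rb] rs.
  rewrite -[x r - q](subrKA (x s)) [ltRHS]addrC.
  apply: le_lt_trans (ler_normD _ _) _; rewrite ltrD2r.
  by apply: Hd => //; rewrite ?sb ?rb ?(le_trans a0 as') ?(le_trans a0 ar).
move=> r /andP[ar rb] Hr.
rewrite -[x r - q](subrKA (x a)).
apply: le_trans (ler_normD _ _) _.
have : `|x r - x a| <= B * (r - a).
  apply: (solution_increment_le sx a0 ar B0 uc) => s /andP[as' sr] us.
  by apply: fB => //; apply: Hr; rewrite (ltW as').
have : B * (r - a) <= B * h by rewrite ler_wpM2l// lerBlDl.
by lra.
Qed.

(** Let [e] be the initial distance.  While the distance is at most [k], the
    difference of the solutions changes by at most [L k (b - a) <= k / 4].  For
    [k] slightly above [2 e] this improves the bound strictly, so the distance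
    stays at most [2 e], and then the difference changes by at most [e / 2].
    The conclusion says that the flow across the step is the identity up to a
    map with Lipschitz constant 1/2. *)
Lemma solution_tube p u x q w y (a b L d : R) :
  solution f p u x -> solution f q w y -> 0 <= a -> a <= b ->
  0 <= L -> L * (b - a) <= 1 / 4 -> 0 < d ->
  (forall t, a < t < b -> w t = u t) ->
  (forall t, a <= t <= b -> forall z z' v,
     `|z - x t| <= d -> `|z' - x t| <= d -> `|f z v - f z' v| <= L * `|z - z'|) ->
  `|y a - x a| <= d / 4 ->
  forall t, a <= t <= b ->
    `|(y t - x t) - (y a - x a)| <= `|y a - x a| / 2.
Proof.
move=> sx sy a0 ab L0 Lab d0 wu fL yax.
pose e := `|y a - x a|.
have grow k c : 0 <= k -> k <= d -> a <= c <= b ->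
    (forall s, a <= s < c -> `|y s - x s| <= k) ->
    `|(y c - x c) - (y a - x a)| <= k / 4.
  move=> k0 kd /andP[ac cb] Hk.
  apply: (@le_trans _ _ ((L * k) * (c - a))).
    apply: (solution_diff_le sy sx a0 ac); first exact: mulr_ge0.
      by move=> t /andP[at' tc]; rewrite wu// at' (lt_le_trans tc).
    move=> t /andP[at' tc].
    have yxt : `|y t - x t| <= k by apply: Hk; rewrite (ltW at').
    have tab : a <= t <= b by rewrite (ltW at') (ltW (lt_le_trans tc cb)).
    apply: le_trans (fL t tab _ _ _ (le_trans yxt kd) _) _.
      by rewrite subrr normr0 ltW.
    exact: ler_wpM2l.
  have Lca : L * (c - a) <= 1 / 4.
    by apply: le_trans Lab; rewrite ler_wpM2l// lerD2r.
  by rewrite mulrAC; have := ler_wpM2r k0 Lca; lra.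
(* The slack [j] makes the improvement strict also for [e = 0]. *)
have yx t : a <= t <= b -> `|y t - x t| <= 2 * e.
  move=> tab; apply/ler_addgt0Pr => i i0.
  pose j := Num.min (i / 2) (d / 4).
  have j0 : 0 < j by rewrite lt_min !divr_gt0.
  have ji : j <= i / 2 by rewrite ge_min lexx.
  have jd : j <= d / 4 by rewrite ge_min lexx orbT.
  have e0 : 0 <= e by exact: normr_ge0.
  have ed : e <= d / 4 by exact: yax.
  apply: (@le_trans _ _ (e + (2 * e + 2 * j) / 4)); last by lra.
  apply: (barrier (g := fun t => `|y t - x t|) (k := 2 * e + 2 * j) _ _ _ tab).
  - by lra.
  - move=> e' e'0; have e20 : 0 < e' / 2 by rewrite divr_gt0.
    have [d1 d10 H1] := solution_continuous sx b e20.
    have [d2 d20 H2] := solution_continuous sy b e20.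
    exists (Num.min d1 d2); first by rewrite lt_min d10.
    move=> s r /andP[as' sb] /andP[ar rb]; rewrite lt_min => /andP[rs1 rs2].
    have s0b : 0 <= s <= b by rewrite (le_trans a0 as').
    have r0b : 0 <= r <= b by rewrite (le_trans a0 ar).
    have := H1 _ _ s0b r0b rs1; have := H2 _ _ s0b r0b rs2.
    have -> : y r - x r = (y s - x s) + ((y r - y s) - (x r - x s)).
      by rewrite [in RHS]opprB addrCA !subrKA.
    have := ler_normD (y s - x s) ((y r - y s) - (x r - x s)).
    have := ler_normB (y r - y s) (x r - x s).
    lra.
  - move=> c cab Hc.
    rewrite -[y c - x c](subrK (y a - x a)) addrC.
    apply: le_trans (ler_normD _ _) _; rewrite lerD2l.
    by apply: grow => //; lra.
move=> t tab; have e0 : 0 <= e by exact: normr_ge0.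
have ed : e <= d / 4 by exact: yax.
apply: le_trans (grow (2 * e) _ _ _ tab _) _; try lra.
  move=> s /andP[as' st]; apply: yx; rewrite as' /=.
  by case/andP: tab => _; apply: le_trans; exact: ltW.
by rewrite -/e; lra.
Qed.

End ShortSteps.

Section ShortStepFlow.
Variables (R : realType) (n m : nat).
Variable f : 'rV[R]_n -> 'rV[R]_m -> 'rV[R]_n.
Implicit Types (x y : R -> 'rV[R]_n) (u w : R -> 'rV[R]_m).
Variables (x : R -> 'rV[R]_n) (u w : R -> 'rV[R]_m) (a b L d : R).
Hypotheses (sx : solution f (x 0) u x) (a0 : 0 <= a) (ab : a <= b).
Hypotheses (L0 : 0 <= L) (Lab : L * (b - a) <= 1 / 4) (d0 : 0 < d).
Hypothesis wu : forall t, a < t < b -> w t = u t.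
Hypothesis fL : forall t, a <= t <= b -> forall z z' v,
  `|z - x t| <= d -> `|z' - x t| <= d -> `|f z v - f z' v| <= L * `|z - z'|.

Lemma short_step_track y : solution f (y 0) w y -> `|y a - x a| <= d / 4 ->
  forall t, a <= t <= b -> `|y t - x t| <= 2 * `|y a - x a|.
Proof.
move=> sy yax t tab.
have H := solution_tube sx sy a0 ab L0 Lab d0 wu fL yax tab.
rewrite -[y t - x t](subrK (y a - x a)).
apply: le_trans (ler_normD _ _) _.
have := normr_ge0 (y a - x a); lra.
Qed.

(** The tube estimate with [y], instead of [x], as the reference solution: [y]
    stays within [d / 2] of [x], so the vector field is still Lipschitz within
    [d / 2] of [y]. *)
Lemma short_step_diff y y' :
  solution f (y 0) w y -> solution f (y' 0) w y' ->
  `|y a - x a| <= d / 16 -> `|y' a - x a| <= d / 16 ->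
  forall t, a <= t <= b ->
    `|(y' t - y t) - (y' a - y a)| <= `|y' a - y a| / 2.
Proof.
move=> sy sy' ya y'a t tab.
have d20 : 0 < d / 2 by rewrite divr_gt0.
apply: (solution_tube sy sy' a0 ab L0 Lab d20) => //.
  move=> r rab z z' v zy zy'.
  have yxr : `|y r - x r| <= d / 2.
    apply: le_trans (short_step_track sy _ rab) _; lra.
  have tube z1 : `|z1 - y r| <= d / 2 -> `|z1 - x r| <= d.
    move=> H; rewrite -(subrKA (y r)); apply: le_trans (ler_normD _ _) _; lra.
  by apply: (fL rab); exact: tube.
rewrite -(subrKA (x a)); apply: le_trans (ler_normD _ _) _.
rewrite (distrC (x a)); lra.
Qed.

(** The flow across the step can be inverted near the reference solution.  A
    solution through [z'] at time [a] arrives at [z] at time [b] exactly if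
    [z'] is a fixed point of [z' |-> z - (y_z' b - z')], and this map is a
    contraction since the flow is close to the identity.  The solutions [y_z']
    are global ones that pass through [z'] at time [a]; the predicate [P]
    carries along what is known about them on [[0, a]]. *)
Lemma short_step_onto (beta : R) (P : (R -> 'rV[R]_n) -> Prop) :
  0 <= beta -> 2 * beta <= d / 16 ->
  (forall z, `|z - x a| <= 2 * beta ->
     exists y, [/\ solution f (y 0) w y, y a = z & P y]) ->
  forall z, `|z - x b| <= beta ->
     exists y, [/\ solution f (y 0) w y, `|y a - x a| <= 2 * beta, y b = z & P y].
Proof.
move=> beta0 bd start z zb.
have : forall z', exists y, `|z' - x a| <= 2 * beta ->
    [/\ solution f (y 0) w y, y a = z' & P y].
  move=> z'; have [/start[y Hy]|] := pselect (`|z' - x a| <= 2 * beta).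
    by exists y.
  by move=> nz'; exists x.
move=> /choice[Y HY].
have bab : a <= b <= b by rewrite ab lexx.
pose G z' := z - (Y z' b - z').
have [|z' z'U|z1 z2 z1U z2U|z' z'U] :=
  @half_contraction_fixpoint R n G (x a) (2 * beta).
- by rewrite mulr_ge0.
- have [sy ya _] := HY _ z'U.
  have ya4 : `|Y z' a - x a| <= d / 4 by rewrite ya; lra.
  have := solution_tube sx sy a0 ab L0 Lab d0 wu fL ya4 bab.
  rewrite ya => H.
  have -> : G z' - x a = (z - x b) - ((Y z' b - x b) - (z' - x a)).
    by apply/rowP => i; rewrite !mxE; ring.
  by apply: le_trans (ler_normB _ _) _; lra.
- have [sy1 y1a _] := HY _ z1U; have [sy2 y2a _] := HY _ z2U.
  have y1d : `|Y z1 a - x a| <= d / 16 by rewrite y1a; lra.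
  have y2d : `|Y z2 a - x a| <= d / 16 by rewrite y2a; lra.
  have := short_step_diff sy1 sy2 y1d y2d bab.
  rewrite y1a y2a (distrC z2) => H.
  have -> : G z1 - G z2 = (Y z2 b - Y z1 b) - (z2 - z1)
    by apply/rowP => i; rewrite !mxE; ring.
  exact: H.
- have [sy ya Py] := HY _ z'U; rewrite /G => Gz'.
  exists (Y z'); split=> //; first by rewrite ya.
  apply/rowP => i; have /rowP/(_ i) := Gz'; rewrite !mxE; lra.
Qed.

End ShortStepFlow.

(** * Essential norms and concatenation of inputs *)

Section Inputs.
Variables (R : realType) (m : nat).
Implicit Types u : R -> 'rV[R]_m.

(** The essential norm is defined by the Lebesgue measure restricted to the
    half-line. *)
Lemma ae_restrP (P : R -> Prop) :
  (\forall t \ae mrestr (@lebesgue_measure R) (measurable_itv `[(0 : R), +oo[), P t)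
  <-> {ae @lebesgue_measure R, forall t, 0 <= t -> P t}.
Proof.
split=> [[A [mA A0 HA]]|[A [mA A0 HA]]].
  exists (A `&` `[0, +oo[%classic); split=> //; first exact: measurableI.
  move=> t /= nP; have t0 : 0 <= t.
    by apply: contrapT => nt; apply: nP => /nt.
  by split; [apply: HA => /= Pt; apply: nP | rewrite /= in_itv /= t0].
exists (A `|` ~` `[0, +oo[%classic); split.
- by apply: measurableU => //; exact: measurableC.
- rewrite /= /mrestr setIUl setICl setU0; apply/eqP; rewrite -measure_le0.
  rewrite -[leRHS]A0; apply: le_measure; rewrite ?inE//.
  exact: measurableI.
- move=> t /= nP; have [t0|t0] := leP 0 t; last first.
    by right; rewrite /= in_itv /= andbT; apply/negP; rewrite -ltNge.
  by left; apply: HA => /= Pt; apply: nP; exact: Pt.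
Qed.

Lemma inputs_ae_le u c : inputs u -> Unorm u <= c ->
  {ae @lebesgue_measure R, forall t, 0 <= t -> enorm (u t) <= c}.
Proof.
move=> [_ uoo] uc; apply/ae_restrP.
have := ess_sup_inf.ess_sup_ge (mrestr (@lebesgue_measure R)
  (measurable_itv `[(0 : R), +oo[)) (fun t => (enorm (u t))%:E).
apply: (@filterS _ _ (ae_filter_ringOfSetsType _)) => t.
rewrite -/(essnorm u) -lee_fin => /le_trans; apply.
apply: le_trans (_ : _ <= (Unorm u)%:E)%E _; last by rewrite lee_fin.
by move: uoo; rewrite /Unorm; case: (essnorm u) => [r _|//|_];
  rewrite ?leNye ?lexx.
Qed.

Lemma Unorm_ge0 u : inputs u -> 0 <= Unorm u.
Proof.
move=> [_ uoo]; apply: fine_ge0; apply: ess_sup_inf.ess_sup_gee.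
  by rewrite /= /mrestr setTI lebesgue_measure_itv /= ltry addye.
by apply: aeW => t; rewrite lee_fin sqrtr_ge0.
Qed.

Lemma inputs_of_ae_le u c : 0 <= c ->
  (forall i, measurable_fun `[(0 : R), +oo[ (fun t => u t ord0 i)) ->
  {ae @lebesgue_measure R, forall t, 0 <= t -> enorm (u t) <= c} ->
  inputs u /\ Unorm u <= c.
Proof.
move=> c0 mu uc.
have uc' : (essnorm u <= c%:E)%E.
  apply/ess_sup_inf.ess_supP; apply/ae_restrP.
  apply: (@filterS _ _ (ae_filter_ringOfSetsType _)) uc
    => t H t0; rewrite lee_fin; exact: H.
split; first by split=> //; exact: le_lt_trans (ltry c).
by move: uc'; rewrite /Unorm; case: (essnorm u).
Qed.

Definition concat_input (tau : nat -> R) (u : nat -> R -> 'rV[R]_m) (s : R) :=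
  xget 0 [set v | exists2 j, tau j <= s < tau j.+1 & v = u j s].

Variables (tau : nat -> R) (u : nat -> R -> 'rV[R]_m).
Hypothesis tau0 : 0 <= tau 0.
Hypothesis tauS : forall j, tau j <= tau j.+1.

Lemma breakpoints_le i j : (i <= j)%N -> tau i <= tau j.
Proof. by apply: (homo_leq (r := <=%R)) => //; exact: le_trans. Qed.

Lemma concat_inputE j s : tau j <= s < tau j.+1 -> concat_input tau u s = u j s.
Proof.
move=> sj; rewrite /concat_input.
case: xgetP => [_ -> [i si ->]|/(_ (u j s))]; last first.
  by case; exists j.
suff -> : i = j by [].
case/andP: si => i1 i2; case/andP: sj => j1 j2.
case: (ltngtP i j) => // [ij|ji].
  by have := le_lt_trans (le_trans (breakpoints_le ij) j1) i2; rewrite ltxx.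
by have := le_lt_trans (le_trans (breakpoints_le ji) i1) j2; rewrite ltxx.
Qed.

(** If the breakpoints accumulate, the concatenation is 0 from their supremum
    on, so it is an input in either case. *)
Lemma concat_input_inputs c : 0 <= c ->
  (forall j, inputs (u j)) -> (forall j, Unorm (u j) <= c) ->
  inputs (concat_input tau u) /\ Unorm (concat_input tau u) <= c.
Proof.
move=> c0 iu uc; pose I j : set R := `[tau j, tau j.+1[%classic.
have out s : ~ (\bigcup_j I j) s -> concat_input tau u s = 0.
  move=> ns; apply: xgetPN => v [j sj _]; apply: ns.
  by exists j => //=; rewrite in_itv.
apply: inputs_of_ae_le => // [i|].
  pose D : set R := `[0, +oo[%classic.
  have mI j : measurable (I j) by exact: measurable_itv.
  have mD : measurable D by exact: measurable_itv.
  have mU : measurable (\bigcup_j I j).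
    by apply: bigcup_measurable => j _; exact: mI.
  have mO : measurable (D `\` \bigcup_j I j) by exact: measurableD.
  have -> : `[0, +oo[%classic = (\bigcup_j I j) `|` (D `\` \bigcup_j I j).
    rewrite setDUK// => s [j _]; rewrite /I /D /= !in_itv /= andbT => /andP[js _].
    by apply: le_trans js; apply: le_trans (breakpoints_le (leq0n j)).
  apply/measurable_funU => //; split.
    apply/measurable_fun_bigcup => // j.
    apply: (@eq_measurable_fun _ _ _ _ (I j) (fun s => u j s ord0 i)).
      by move=> s; rewrite inE /I /= in_itv /= => /concat_inputE ->.
    have [mu _] := iu j; apply: measurable_funS (mu i) => //.
    move=> s; rewrite /I /= !in_itv /= andbT => /andP[js _].
    by apply: le_trans js; apply: le_trans (breakpoints_le (leq0n j)).
  apply: (@eq_measurable_fun _ _ _ _ _ (cst (0 : R))) => //.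
  by move=> s; rewrite inE => -[_ ns]; rewrite out// mxE.
have : {ae @lebesgue_measure R, forall s j, 0 <= s -> enorm (u j s) <= c}.
  by apply: ae_foralln => j; exact: inputs_ae_le.
apply: (@filterS _ _ (ae_filter_ringOfSetsType _)) => s H s0.
have [[j _]|ns] := pselect ((\bigcup_j I j) s).
  by rewrite /I /= in_itv /= => /concat_inputE ->; exact: H.
by rewrite out// /enorm big1 ?sqrtr0// => k _; rewrite mxE expr0n.
Qed.

End Inputs.

(** * Shadowing concatenated trajectories *)

Section ChainShadowing.
Variables (R : realType) (n m : nat).
Variable f : 'rV[R]_n -> 'rV[R]_m -> 'rV[R]_n.
Hypothesis fc : forward_complete f.

Variables (c eta : R) (t : nat -> R) (p : nat -> 'rV[R]_n) (L d : nat -> R).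
Variables (q : nat -> 'rV[R]_n) (u : nat -> R -> 'rV[R]_m).

(** [radius j] is the size of the ball around [p j] that solutions with the
    concatenated input are shown to reach, and [radius j.+1] is the tolerance
    for the pieces at both ends of step [j].  A target within [radius j.+1] of
    [p j.+1] is within [2 * radius j.+1] of the piece, and pulling it back
    leads to within [4 * radius j.+1] of the piece, hence to within
    [5 * radius j.+1 <= radius j] of [p j].  Over the step the distance to the
    piece is at most [8 * radius j.+1 <= radius j].  The factor 64 makes
    [4 * radius j.+1] at most [d j / 16], as the short step lemmas require. *)
Fixpoint radius (j : nat) : R :=
  if j is i.+1 then Num.min (radius i / 8) (d i / 64) else eta.

Let x j s := phi f s (q j) (u j).

Hypotheses (eta0 : 0 < eta) (c0 : 0 <= c).
Hypotheses (t0 : t 0 = 0) (tS : forall j, t j <= t j.+1).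
Hypotheses (L0 : forall j, 0 <= L j) (d0 : forall j, 0 < d j).
Hypothesis Lt : forall j, L j * (t j.+1 - t j) <= 1 / 4.
Hypotheses (iu : forall j, inputs (u j)) (uc : forall j, Unorm (u j) <= c).
Hypothesis xL : forall j s, t j <= s <= t j.+1 -> forall z z' v,
  `|z - x j s| <= d j -> `|z' - x j s| <= d j ->
  `|f z v - f z' v| <= L j * `|z - z'|.
Hypothesis xp : forall j, `|x j (t j) - p j| <= radius j.+1.
Hypothesis xpS : forall j, `|x j (t j.+1) - p j.+1| <= radius j.+1.

Lemma radius_gt0 j : 0 < radius j.
Proof. by elim: j => //= j IH; rewrite lt_min !divr_gt0. Qed.

Lemma radiusS8 j : 8 * radius j.+1 <= radius j.
Proof. by rewrite mulrC -ler_pdivlMr//= ge_min lexx. Qed.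

Lemma radiusS64 j : 64 * radius j.+1 <= d j.
Proof. by rewrite mulrC -ler_pdivlMr//= ge_min lexx orbT. Qed.

Lemma radius_le_eta j : radius j <= eta.
Proof.
elim: j => // j IH; apply: le_trans IH.
have := radiusS8 j; have := radius_gt0 j.+1; lra.
Qed.

Let t_ge0 j : 0 <= t j.
Proof. by rewrite -t0; exact: breakpoints_le. Qed.

Let v := concat_input t u.

Let sx j : solution f (x j 0) (u j) (x j).
Proof. exact: solution_init (phi_solution (q j) fc (iu j)). Qed.

Let vu j s : t j < s < t j.+1 -> v s = u j s.
Proof.
by move=> /andP[js sj]; apply: concat_inputE => //; rewrite (ltW js).
Qed.

Let v_inputs : inputs v /\ Unorm v <= c.
Proof. by apply: concat_input_inputs; rewrite ?t0. Qed.

(** Induction on [j]: the correction needed at time [t j.+1] is pulled back over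
    one step, and the induction hypothesis realises the resulting state at time
    [t j] by a solution that starts at time 0. *)
Lemma chain_backward j z : `|z - p j| <= radius j ->
  exists y, [/\ solution f (y 0) v y, y (t j) = z &
    forall i, (i < j)%N -> `|y (t i) - x i (t i)| <= 4 * radius i.+1].
Proof.
elim: j z => [|j IH] z zp.
  exists (fun s => phi f s z v); split=> //; last by rewrite t0 phi0//; case: v_inputs.
  by apply: solution_init (phi_solution z fc _); case: v_inputs.
have r0 := radius_gt0 j.+1.
have r8 := radiusS8 j; have r64 := radiusS64 j.
have onto := short_step_onto (sx j) (t_ge0 j) (tS j) (L0 j) (Lt j) (d0 j)
  (@vu j) (xL (j := j)) (beta := 2 * radius j.+1)
  (P := fun y => forall i, (i < j)%N -> `|y (t i) - x i (t i)| <= 4 * radius i.+1).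
have [||z' z'x||y] := onto _ _ _ z _.
- lra.
- lra.
- apply: IH; rewrite -(subrKA (x j (t j))); apply: le_trans (ler_normD _ _) _.
  have := xp j; lra.
- rewrite -(subrKA (p j.+1)); apply: le_trans (ler_normD _ _) _.
  rewrite (distrC (p j.+1)); have := xpS j; lra.
case=> sy ya yb Py; exists y; split=> // i.
rewrite ltnS leq_eqVlt => /orP[/eqP ->|]; last exact: Py.
by apply: le_trans ya _; lra.
Qed.

(** [chain_backward] gives for each [k] a solution [Y k] that follows the first
    [k] pieces.  The solution from a cluster point [q'] of their initial states
    follows all pieces: over each step the distance between it and [Y k] at
    most doubles, since both remain in the tube. *)
Lemma chain_shadow : exists q' w, [/\ inputs w, Unorm w <= c &
  forall j s, t j <= s <= t j.+1 -> `|phi f s q' w - x j s| <= eta].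
Proof.
have [iv vc] := v_inputs.
have : forall k : nat, exists y, [/\ solution f (y 0) v y &
    forall i, (i <= k)%N -> `|y (t i) - x i (t i)| <= 4 * radius i.+1].
  move=> k; have [|y [sy _ Hy]] := @chain_backward k.+1 (p k.+1).
    by rewrite subrr normr0 ltW// radius_gt0.
  by exists y.
move=> /choice[Y HY].
have Y0 k : `|Y k 0 - x 0 0| <= 4 * radius 1.
  by have [_ /(_ 0%N isT)] := HY k; rewrite t0.
have [q' _ clq] := compact_cluster_point (@compact_norm_ball R n _ _) Y0.
exists q', v; split=> //.
pose y s := phi f s q' v.
have sy : solution f (y 0) v y := solution_init (phi_solution q' fc iv).
have y0 : y 0 = q' by exact: phi0.
have close J : (forall k, (J <= k)%N ->
      `|y (t J) - Y k (t J)| <= 2 ^+ J * `|q' - Y k 0|) ->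
    `|y (t J) - x J (t J)| <= 4 * radius J.+1.
  move=> HJ; apply/ler_addgt0Pr => e e0.
  have J0 : 0 < 2 ^+ J :> R by rewrite exprn_gt0.
  have [k Jk] := clq _ (nbhsx_ballx q' (e / 2 ^+ J) (divr_gt0 e0 J0)) J.
  rewrite -ball_normE /= ltr_pdivlMr// mulrC => qk.
  rewrite -(subrKA (Y k (t J))) addrC; apply: le_trans (ler_normD _ _) _.
  rewrite addrC [leRHS]addrC; apply: lerD; first exact: le_trans (HJ k Jk) (ltW qk).
  by have [_] := HY k; apply.
have track J : forall k, (J <= k)%N ->
    `|y (t J) - Y k (t J)| <= 2 ^+ J * `|q' - Y k 0|.
  elim: J => [k _|J IH k Jk]; first by rewrite t0 y0 expr0 mul1r.
  have [sYk HYk] := HY k.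
  have r0 := radius_gt0 J.+1; have r64 := radiusS64 J.
  have yd : `|y (t J) - x J (t J)| <= d J / 16.
    by apply: le_trans (close J IH) _; lra.
  have Yd : `|Y k (t J) - x J (t J)| <= d J / 16.
    by apply: le_trans (HYk J (ltnW Jk)) _; lra.
  have JJ : t J <= t J.+1 <= t J.+1 by rewrite tS lexx.
  have := short_step_diff (sx J) (t_ge0 J) (tS J) (L0 J) (Lt J) (d0 J)
    (@vu J) (xL (j := J)) sYk sy Yd yd JJ.
  have := IH k (ltnW Jk); rewrite exprS.
  have := ler_normD ((y (t J.+1) - Y k (t J.+1)) - (y (t J) - Y k (t J)))
    (y (t J) - Y k (t J)).
  rewrite subrK; have := normr_ge0 (y (t J) - Y k (t J)); lra.
move=> j s sj; have r0 := radius_gt0 j.+1; have r64 := radiusS64 j.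
have yj : `|y (t j) - x j (t j)| <= 4 * radius j.+1 := close j (track j).
have yd : `|y (t j) - x j (t j)| <= d j / 4 by apply: le_trans yj _; lra.
apply: le_trans (short_step_track (sx j) (t_ge0 j) (tS j) (L0 j) (Lt j) (d0 j)
    (@vu j) (xL (j := j)) sy yd sj) _.
have := radiusS8 j; have := radius_le_eta j; lra.
Qed.

End ChainShadowing.

Section Shadowing.
Variables (R : realType) (n m : nat).
Variable f : 'rV[R]_n -> 'rV[R]_m -> 'rV[R]_n.
Hypotheses (cf : continuous (fun p : 'rV[R]_n * 'rV[R]_m => f p.1 p.2))
  (lf : locally_Lipschitz_unif f) (fc : forward_complete f).

Variables (adm : nat -> 'rV[R]_n -> (R -> 'rV[R]_m) -> Prop) (c : R).
Hypothesis adm_anti : forall j k q u, (j <= k)%N -> adm k q u -> adm j q u.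
Hypothesis adm_inputs : forall k q u, adm k q u -> inputs u /\ Unorm u <= c.
Hypothesis c0 : 0 <= c.

(** The step length, Lipschitz constant and tube radius depend on the norm of
    the current point only through an integer bound; so along a bounded
    sequence of points only finitely many step lengths occur. *)
Lemma step_constants (K : nat) : exists hLd : R * R * R,
  [/\ 0 < hLd.1.1, 0 <= hLd.1.2, 0 < hLd.2, hLd.1.2 * hLd.1.1 <= 1 / 4 &
  (forall x y z v, `|x| <= K.+1%:R -> `|y - x| <= hLd.2 -> `|z - x| <= hLd.2 ->
      `|f y v - f z v| <= hLd.1.2 * `|y - z|) /\
  exists2 B, 0 <= B & B * hLd.1.1 <= 1 / 4 /\
    forall x v, `|x| <= K.+1%:R -> enorm v <= c -> `|f x v| <= B].
Proof.
have [L [d [L0 d0 fL]]] := Lipschitz_tube K.+1%:R lf.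
have [B B0 fB] := field_bounded K.+1%:R c cf.
have LB : 0 < L + B + 1 by rewrite ltr_wpDl ?addr_ge0.
exists (1 / 4 / (L + B + 1), L, d); split=> //=.
- by rewrite !divr_gt0.
- by rewrite mulrA ler_pdivrMr//; lra.
- by split=> //; exists B => //; split=> //; rewrite mulrA ler_pdivrMr//; lra.
Qed.

(** [p] is the limit at time [t] of pairs that are admissible to an arbitrarily
    late level. *)
Definition late_cluster (t : R) (p : 'rV[R]_n) := forall k e, 0 < e ->
  exists q u, adm k q u /\ `|phi f t q u - p| <= e.

(** The same trajectory has to pass near both points; this is what makes the
    jumps between consecutive pieces of the concatenation small. *)
Definition linked (t : R) (p : 'rV[R]_n) (t' : R) (p' : 'rV[R]_n) :=
  forall k e, 0 < e -> exists q u, [/\ adm k q u, `|phi f t q u - p| <= e,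
    `|phi f t' q u - p'| <= e &
    forall s, t <= s <= t' -> `|phi f s q u - p| <= 1].

(** For the step length [h] the trajectories near [p] at time [t] stay in the
    unit ball around [p], so their states at time [t + h] have a cluster
    point. *)
Lemma cluster_step t p (h B : R) : 0 <= t -> late_cluster t p ->
  0 <= h -> 0 <= B -> B * h <= 1 / 4 ->
  (forall z v, `|z - p| <= 1 -> enorm v <= c -> `|f z v| <= B) ->
  exists2 p', linked t p (t + h) p' & late_cluster (t + h) p'.
Proof.
move=> t0 acc h0 B0 Bh fB.
have : forall k : nat, exists qu : 'rV[R]_n * (R -> 'rV[R]_m),
    [/\ adm k qu.1 qu.2, `|phi f t qu.1 qu.2 - p| <= k.+2%:R^-1 &
      forall s, t <= s <= t + h -> `|phi f s qu.1 qu.2 - p| <= 1].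
  move=> k; have [|q [u [a qp]]] := acc k k.+2%:R^-1; first by rewrite invr_gt0.
  exists (q, u); split=> //= s; have [iu uc] := adm_inputs a.
  apply: (solution_stays_near (phi_solution q fc iu) t0 B0 Bh
    (inputs_ae_le iu uc) fB); apply: le_trans qp _.
  by rewrite div1r lef_pV2 ?posrE// ler_nat.
move=> /choice[qu Hqu].
have tth : t <= t + h <= t + h by rewrite lerDl h0 lexx.
have qp k : `|phi f (t + h) (qu k).1 (qu k).2 - p| <= 1.
  by have [_ _] := Hqu k; apply.
have [p' _ clp] := compact_cluster_point (@compact_norm_ball R n _ _) qp.
have lnk : linked t p (t + h) p'.
  move=> k e e0.
  have [j Nj] := clp _ (nbhsx_ballx p' e e0) (maxn k (Num.truncn e^-1)).
  rewrite -ball_normE /= => jp; have [aj tj sj] := Hqu j.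
  exists (qu j).1, (qu j).2; split=> //.
  - by apply: adm_anti aj; apply: leq_trans Nj; exact: leq_maxl.
  - apply: le_trans tj _; rewrite -[e]invrK lef_pV2 ?posrE ?invr_gt0//.
    apply/ltW; apply: lt_le_trans (truncnS_gt _) _; rewrite ler_nat ltnS.
    by apply: leq_trans (leqW Nj); exact: leq_maxr.
  - by rewrite distrC ltW.
exists p' => // k e /(lnk k)[q [u [a _ up _]]]; by exists q, u.
Qed.

(** Suppose that [p0] is a limit of initial states of pairs admissible to
    arbitrarily late levels, where the level is read as a time up to which the
    pair is known to behave well.  Then one trajectory is, at each time, close
    to a pair that is admissible beyond that time.  The initial state [q] is in
    general different from [p0]. *)
Theorem shadowing (p0 : 'rV[R]_n) (eta : R) : 0 < eta <= 1 / 2 ->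
  (forall k e, 0 < e -> exists q u, adm k q u /\ `|q - p0| <= e) ->
  exists q w, [/\ inputs w, Unorm w <= c &
    forall T, 0 <= T -> exists k q' u', [/\ T <= k%:R, adm k q' u' &
      `|phi f T q w - phi f T q' u'| <= eta]].
Proof.
move=> /andP[eta0 eta1] acc0.
have [C HC] := choice step_constants.
pose K (p : 'rV[R]_n) := (Num.truncn `|p|).+1.
have near_K (p z : 'rV[R]_n) : `|z - p| <= 1 -> `|z| <= (K p).+1%:R.
  move=> zp; rewrite -(subrK p z); apply: le_trans (ler_normD _ _) _.
  have := truncnS_gt `|p|; rewrite -/(K p) -[(K p).+1%:R]natr1; lra.
pose St := {s : R * 'rV[R]_n | 0 <= s.1 /\ late_cluster s.1 s.2}.
pose next (s s' : St) := (sval s').1 = (sval s).1 + (C (K (sval s).2)).1.1 /\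
  linked (sval s).1 (sval s).2 (sval s').1 (sval s').2.
have step : forall s : St, {s' | next s s'}.
  move=> [[t p] /= [t0 acc]]; apply: cid.
  have [h0 _ _ _ [_ [B B0 [Bh fB]]]] := HC (K p).
  have [|p' lnk acc'] := cluster_step t0 acc (ltW h0) B0 Bh.
    by move=> z v zp vc; apply: fB => //; exact: near_K.
  have t'0 : 0 <= t + (C (K p)).1.1 by rewrite addr_ge0// ltW.
  by exists (exist _ (t + (C (K p)).1.1, p') (conj t'0 acc')).
have acc0' : late_cluster 0 p0.
  move=> k e /(acc0 k)[q [u [a qp]]]; exists q, u; split=> //.
  by rewrite phi0//; have [] := adm_inputs a.
have [S [S0 SS]] := dependent_choice step (exist _ (0, p0) (conj (lexx 0) acc0')).
pose t j := (sval (S j)).1; pose p j := (sval (S j)).2.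
pose h j := (C (K (p j))).1.1; pose L j := (C (K (p j))).1.2.
pose d j := (C (K (p j))).2.
have t0 : t 0%N = 0 by rewrite /t S0.
have tS j : t j.+1 = t j + h j by have [] := SS j.
have h0 j : 0 < h j by have [] := HC (K (p j)).
have tS' j : t j <= t j.+1 by rewrite tS lerDl ltW.
have L0 j : 0 <= L j by have [] := HC (K (p j)).
have d0 j : 0 < d j by have [] := HC (K (p j)).
have Lt j : L j * (t j.+1 - t j) <= 1 / 4.
  by rewrite tS addrC addKr; have [] := HC (K (p j)).
pose rad := radius eta d.
have rad0 j : 0 < rad j by exact: radius_gt0.
pose k j := (Num.truncn (t j.+1)).+1.
have : forall j, exists qu : 'rV[R]_n * (R -> 'rV[R]_m),
    [/\ adm (k j) qu.1 qu.2, `|phi f (t j) qu.1 qu.2 - p j| <= rad j.+1,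
      `|phi f (t j.+1) qu.1 qu.2 - p j.+1| <= rad j.+1 &
      forall s, t j <= s <= t j.+1 -> `|phi f s qu.1 qu.2 - p j| <= 1].
  by move=> j; have [_ /(_ (k j) _ (rad0 j.+1))[q [u H]]] := SS j; exists (q, u).
move=> /choice[qu Hqu].
have iu j : inputs (qu j).2 by have [/adm_inputs[]] := Hqu j.
have uc j : Unorm (qu j).2 <= c by have [/adm_inputs[]] := Hqu j.
have [|||q [w [iw wc shadow]]] := @chain_shadow R n m f fc c eta t p L d
    (fun j => (qu j).1) (fun j => (qu j).2) eta0 c0 t0 tS' L0 d0 Lt iu uc.
- move=> j s sj z z' v; have [_ _ _ _ [fL _]] := HC (K (p j)); apply: fL.
  by apply: near_K; have [_ _ _] := Hqu j; apply.
- by move=> j; have [] := Hqu j.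
- by move=> j; have [] := Hqu j.
exists q, w; split=> // T T0.
(* If all times are at most [T], the solution [phi f _ q w] is bounded on
   [[0, T]], hence the [p j] are bounded and the steps have a positive lower
   bound [h']. *)
have tinf : exists j, T < t j.
  apply: contrapT => nT.
  have tT j : t j <= T by rewrite leNgt; apply/negP => ?; apply: nT; exists j.
  have t_ge0 j : 0 <= t j by rewrite -t0; exact: breakpoints_le.
  have [M HM] := solution_bounded T (phi_solution q fc iw).
  pose N := (Num.truncn (M + 1)).+1.
  have KN j : (K (p j) <= N)%N.
    rewrite ltnS; apply: le_truncn; rewrite -lerBlDr.
    have tj : t j <= t j <= t j.+1 by rewrite lexx tS'.
    have [_ pj _ _] := Hqu j.
    have := shadow j _ tj; have := HM (t j); rewrite t_ge0 tT => /(_ isT).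
    have rj : rad j.+1 <= eta by exact: radius_le_eta.
    have -> : p j = phi f (t j) q w - ((phi f (t j) q w - phi f (t j) (qu j).1 (qu j).2)
        + (phi f (t j) (qu j).1 (qu j).2 - p j)) by rewrite subrKA opprB addrC subrK.
    have := ler_normB (phi f (t j) q w)
      ((phi f (t j) q w - phi f (t j) (qu j).1 (qu j).2)
        + (phi f (t j) (qu j).1 (qu j).2 - p j)).
    have := ler_normD (phi f (t j) q w - phi f (t j) (qu j).1 (qu j).2)
      (phi f (t j) (qu j).1 (qu j).2 - p j).
    lra.
  have [h' h'0 Hh'] : exists2 h', 0 < h' & forall i, (i <= N)%N -> h' <= (C i).1.1.
    elim: N {KN} => [|N [h' h'0 Hh']].
      by exists (C 0%N).1.1; [have [] := HC 0%N | case].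
    exists (Num.min h' (C N.+1).1.1).
      by rewrite lt_min h'0; have [] := HC N.+1.
    move=> i; rewrite leq_eqVlt => /orP[/eqP ->|]; rewrite ge_min.
      by rewrite lexx orbT.
    by rewrite ltnS => /Hh' ->.
  have tj j : j%:R * h' <= t j.
    elim: j => [|j IH]; first by rewrite mul0r.
    by rewrite tS -natr1 mulrDl mul1r; apply: lerD => //; exact: Hh'.
  have := tj (Num.truncn (T / h')).+1; have := tT (Num.truncn (T / h')).+1.
  have := truncnS_gt (T / h'); rewrite ltr_pdivrMr//; lra.
case: (ex_minnP tinf) => [[|j] Tj jmin]; first by move: Tj; rewrite t0 ltNge T0.
have jT : t j <= T by rewrite leNgt; apply/negP => /jmin; rewrite ltnn.
have [aj _ _ _] := Hqu j.
exists (k j), (qu j).1, (qu j).2; split=> //.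
  by apply: ltW; apply: lt_trans Tj _; exact: truncnS_gt.
by apply: shadow; rewrite jT ltW.
Qed.

End Shadowing.

(** * From LIM to ULIM *)

Section ComparisonFunctions.
Variable R : realType.
Implicit Type g : R -> R.

(** The new gain is of class K also if the given one is zero, and it dominates
    both the given gain and the identity. *)
Lemma class_K0_addid g : class_K0 g ->
  exists2 g', class_K g' & forall r, 0 <= r -> g' r = g r + r.
Proof.
case=> [[cg ig g0]|g0]; last first.
  exists id; last by move=> r /g0 ->; rewrite add0r.
  by split=> //; apply: continuous_subspaceT => x; exact: cvg_id.
exists (fun r => g r + r) => //; split=> [r|a b a0 ab|]; last by rewrite g0 add0r.
  apply: cvgD; first exact: cg.
  have cid : {within `[(0 : R), +oo[, continuous (@id R)}.
    by apply: continuous_subspaceT => x; exact: cvg_id.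
  exact: cid.
by apply: ltrD => //; exact: ig.
Qed.

Lemma class_K_le g a b : class_K g -> 0 <= a -> a <= b -> g a <= g b.
Proof.
move=> [_ ig _] a0; rewrite le_eqVlt => /orP[/eqP -> //|ab].
by apply: ltW; exact: ig.
Qed.

Lemma class_K_ge0 g a : class_K g -> 0 <= a -> 0 <= g a.
Proof. by move=> Kg a0; have [_ _ <-] := Kg; exact: class_K_le. Qed.

Lemma class_K_continuous g s e : class_K g -> 0 <= s -> 0 < e ->
  exists2 d, 0 < d & forall r, 0 <= r -> `|r - s| < d -> `|g r - g s| < e.
Proof.
move=> [/subspace_continuousP cg _ _] s0 e0.
have /cg/cvgrPdist_lt/(_ e e0) : (`[(0 : R), +oo[%classic : set R) s.
  by rewrite /= in_itv /= s0.
move=> /nbhs_ballP[d /= d0 Hd]; exists d => // r r0 rs; rewrite distrC.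
apply: Hd; first by rewrite /ball /= distrC.
by rewrite /= in_itv /= r0.
Qed.

End ComparisonFunctions.

(** The trajectories outside the ball of radius [e + g' (Unorm u)] up to time
    [k] form the admissible pairs of level [k], with the input norms restricted to a
    small interval around an accumulation point [s], on which [g'] varies by
    less than [e / 4].  A shadowing trajectory then stays outside the ball of
    radius [e / 4 + g (Unorm w)]: at most [e / 4] is lost for each of the approximation of the state, the
    norm of [u'] and the norm of the concatenated input. *)
Theorem LIM_ULIM (R : realType) (n m : nat)
    (f : 'rV[R]_n -> 'rV[R]_m -> 'rV[R]_n) :
  continuous (fun p : 'rV[R]_n * 'rV[R]_m => f p.1 p.2) ->
  locally_Lipschitz_unif f -> forward_complete f -> LIM f -> ULIM f.
Proof.
move=> cf lf fc [g Kg limg].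
have [g' Kg' g'E] := class_K0_addid Kg.
have g_le r : 0 <= r -> g r <= g' r by move=> r0; rewrite g'E// lerDl.
have g_ge0 r : 0 <= r -> 0 <= g r.
  by move=> r0; case: Kg => [K|->//]; exact: class_K_ge0.
exists g'; first by left.
move=> e r e0 r0; apply: contrapT => nU.
have : forall k : nat, exists xu : 'rV[R]_n * (R -> 'rV[R]_m),
    [/\ enorm xu.1 <= r, inputs xu.2 & forall t, 0 <= t <= k%:R ->
      e + g' (Unorm xu.2) < enorm (phi f t xu.1 xu.2)].
  move=> k; apply: contrapT => nk; apply: nU; exists k%:R => x u xr iu.
  apply: contrapT => nt; apply: nk; exists (x, u); split=> // t tk.
  by rewrite ltNge; apply/negP => H; apply: nt; exists t.
move=> /choice[xu Hxu].
(* Time 0 already bounds the input norms, thanks to the identity in [g']. *)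
have Ur k : 0 <= Unorm (xu k).2 <= r.
  have [xr iu av] := Hxu k; have U0 := Unorm_ge0 iu; rewrite U0 /=.
  have := av 0; rewrite lexx ler0n phi0// => /(_ isT).
  by rewrite g'E//; have := g_ge0 _ U0; lra.
have cpt := compact_setX (@compact_norm_ball0 R n r) (@segment_compact R 0 r).
have [|[p s] [/= pr sr] clp] :=
    compact_cluster_point (x := fun k => ((xu k).1, Unorm (xu k).2)) cpt.
  move=> k; split=> /=; last by rewrite in_itv /= Ur.
  by have [xr _ _] := Hxu k; apply: le_trans (normr_le_enorm _) xr.
have s0 : 0 <= s by move: sr; rewrite in_itv => /andP[].
have e40 : 0 < e / 4 by rewrite divr_gt0.
have [d d0 Hd] := class_K_continuous Kg' s0 e40.
have d20 : 0 < d / 2 by rewrite divr_gt0.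
pose adm (k : nat) (q : 'rV[R]_n) (u : R -> 'rV[R]_m) :=
  [/\ inputs u, `|Unorm u - s| <= d / 2 & forall t, 0 <= t <= k%:R ->
      e + g' (Unorm u) < enorm (phi f t q u)].
pose c := s + d / 2.
pose eta := Num.min (1 / 2) (e / 4 / n.+1%:R).
have eta0 : 0 < eta <= 1 / 2.
  by rewrite ge_min lexx andbT lt_min !divr_gt0.
have [||||q [w [iw wc shadow]]] := @shadowing R n m f cf lf fc adm c _ _ _ p eta eta0.
- move=> j k q u jk [iu us av]; split=> // t /andP[t0 tj]; apply: av.
  by rewrite t0 (le_trans tj)// ler_nat.
- move=> k q u [iu us _]; split=> //; rewrite /c -lerBlDl.
  exact: le_trans (ler_norm _) us.
- by rewrite addr_ge0// ltW.
- move=> k b b0.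
  have bd0 : 0 < Num.min b (d / 2) by rewrite lt_min b0.
  have [j kj [/= pj sj]] := clp _ (nbhsx_ballx (p, s) _ bd0) k.
  have [_ iu av] := Hxu j.
  exists (xu j).1, (xu j).2; split; last first.
    move: pj; rewrite -ball_normE /= lt_min distrC => /andP[pj _]; exact: ltW.
  split=> //.
    by move: sj; rewrite /ball /= lt_min distrC => /andP[_ sj]; exact: ltW.
  by move=> t /andP[t0 tk]; apply: av; rewrite t0 (le_trans tk)// ler_nat.
have [T T0 limT] := limg q w (e / 4) iw e40.
have [k [q' [u' [Tk [iu us av] near_T]]]] := shadow T T0.
have Uw0 := Unorm_ge0 iw; have Uu0 := Unorm_ge0 iu.
have gw : g (Unorm w) <= g' c by apply: le_trans (g_le _ Uw0) (class_K_le Kg' Uw0 wc).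
have gc : g' c - g' s < e / 4.
  apply: le_lt_trans (ler_norm _) _; apply: Hd; first by rewrite addr_ge0// ltW.
  by rewrite /c addrC addKr gtr0_norm//; lra.
have gu : g' s - g' (Unorm u') < e / 4.
  apply: le_lt_trans (ler_norm _) _; rewrite distrC; apply: Hd => //.
  by apply: le_lt_trans us _; lra.
have avT := av T; rewrite T0 Tk in avT.
have := avT isT; apply/negP; rewrite -leNgt.
apply: le_trans (enorm_dist_le _ (phi f T q w)) _.
have : n.+1%:R * `|phi f T q' u' - phi f T q w| <= e / 4.
  rewrite mulrC -ler_pdivlMr// distrC; apply: le_trans near_T _.
  by rewrite ge_min lexx orbT.
lra.
Qed.

Lemma ULIM_LIM (R : realType) (n m : nat)
    (f : 'rV[R]_n -> 'rV[R]_m -> 'rV[R]_n) : ULIM f -> LIM f.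
Proof.
move=> [g Kg ulim]; exists g => // x u e iu e0.
have r0 : 0 < enorm x + 1 by rewrite ltr_wpDl ?sqrtr_ge0.
have [tau Htau] := ulim e _ e0 r0.
have [|t /andP[t0 _] Ht] := Htau x u _ iu; first by rewrite lerDl.
by exists t.
Qed.

Theorem proposition13 (R : realType) (n m : nat)
    (f : 'rV[R]_n -> 'rV[R]_m -> 'rV[R]_n) :
  continuous (fun p : 'rV[R]_n * 'rV[R]_m => f (fst p) (snd p)) ->
  locally_Lipschitz_unif f ->
  forward_complete f ->
  (LIM f <-> ULIM f).
Proof. by move=> cf lf fc; split; [exact: LIM_ULIM | exact: ULIM_LIM]. Qed.
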